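(* For every integer $i\ge 1$, $\mathrm{PL}^i\subsetneq\mathrm{PL}^{i+1}$.
   Context: A random-access Turing machine (RATM) is a Turing machine with $k\ge 2$ ordinary tapes (a read-only input tape, an output tape and work tapes), each equipped with its own write-only binary index tape; in each step it reads the symbols under the ordinary heads, writes on the writable ordinary tapes and on the index tapes, moves all heads, and changes state; when it enters a special random-access state $q_a$, the heads of all ordinary tapes jump (in that step) to the cells whose addresses are written in binary on the respective index tapes. Running time is the number of steps. For $i\ge 1$, $\mathrm{PL}^i$ is the class of decision problems solvable by a RATM in time $O(\log^i n)$, where $n$ is the input length. *)

(* Defs.v *)
From Stdlib Require Import Reals.
From mathcomp Require Import all_boot.

Set Implicit Arguments.
Unset Strict Implicit.
Unset Printing Implicit Defensive.

Variant direction : Type := MoveL | MoveS | MoveR.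

(* Tapes are one-way infinite, with cells 0, 1, 2, ...; a left move from      *)
(* cell 0 leaves the head in place.                                           *)
Definition move_head (d : direction) (h : nat) : nat :=
  match d with MoveL => h.-1 | MoveS => h | MoveR => h.+1 end.

(* One line of the transition table of a machine with w.+2 ordinary tapes.    *)
(* Tape ord0 is the input tape; [act_write j] is written on the writable tape *)
(* [lift ord0 j], the output tape being [lift ord0 ord0]. Index tapes have    *)
(* the alphabet {0, 1, blank}, represented as [option bool].                  *)
Record action (Q Gamma : finType) (w : nat) : Type := Action {
  act_state : Q;
  act_write : {ffun 'I_w.+1 -> Gamma};
  act_index_write : {ffun 'I_w.+2 -> option bool};
  act_move : {ffun 'I_w.+2 -> direction};
  act_index_move : {ffun 'I_w.+2 -> direction}
}.

Record ratm : Type := RATM {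
  state : finType;
  alphabet : finType;
  nwork : nat;
  blank : alphabet;
  insym : bool -> alphabet;
  insym_inj : injective insym;
  insym_blank : forall b, insym b != blank;
  qstart : state;
  qaccess : state;
  qaccept : state;
  qreject : state;
  special_uniq : uniq [:: qaccess; qaccept; qreject];
  delta : state -> {ffun 'I_nwork.+2 -> alphabet} -> action state alphabet nwork
}.

(* A tape is the finite sequence of its first cells, all others being blank.  *)
Record config (M : ratm) : Type := Config {
  cstate : state M;
  tape : {ffun 'I_(nwork M).+2 -> seq (alphabet M)};
  tape_head : {ffun 'I_(nwork M).+2 -> nat};
  index_tape : {ffun 'I_(nwork M).+2 -> seq (option bool)};
  index_head : {ffun 'I_(nwork M).+2 -> nat}
}.

(* The binary word written from cell 0 up to the first blank, most            *)
(* significant bit first; the empty word denotes address 0.                   *)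
Fixpoint address_rec (a : nat) (s : seq (option bool)) : nat :=
  if s is Some b :: s' then address_rec (a.*2 + b) s' else a.

Definition address (s : seq (option bool)) : nat := address_rec 0 s.

Section Semantics.

Variable M : ratm.

Definition init_config (x : seq bool) : config M :=
  {| cstate := qstart M;
     tape := [ffun t => if t == ord0 then map (@insym M) x else [::]];
     tape_head := [ffun=> 0];
     index_tape := [ffun=> [::]];
     index_head := [ffun=> 0] |}.

Definition halted (c : config M) : bool :=
  (cstate c == qaccept M) || (cstate c == qreject M).

Definition scanned (c : config M) : {ffun 'I_(nwork M).+2 -> alphabet M} :=
  [ffun t => nth (blank M) (tape c t) (tape_head c t)].

(* A jump replaces the head moves of the step that enters the random-access   *)
(* state, and uses the index tapes as they are after the writes of that step. *)
Definition step (c : config M) : config M :=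
  if halted c then c else
  let a := delta (cstate c) (scanned c) in
  let itape : {ffun 'I_(nwork M).+2 -> seq (option bool)} :=
    [ffun t => set_nth None (index_tape c t) (index_head c t)
                 (act_index_write a t)] in
  {| cstate := act_state a;
     tape := [ffun t => if unlift ord0 t is Some j
                        then set_nth (blank M) (tape c t) (tape_head c t)
                               (act_write a j)
                        else tape c t];
     tape_head := [ffun t => if act_state a == qaccess M
                             then address (itape t)
                             else move_head (act_move a t) (tape_head c t)];
     index_tape := itape;
     index_head := [ffun t => move_head (act_index_move a t) (index_head c t)] |}.

Definition run (x : seq bool) (n : nat) : config M :=
  iter n step (init_config x).

Definition decides_in_time (L : seq bool -> Prop) (T : nat -> nat) : Prop :=
  forall x, exists n, [/\ n <= T (size x), halted (run x n)
                        & cstate (run x n) = qaccept M <-> L x].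

End Semantics.

Local Open Scope R_scope.

Definition bigO (f g : nat -> R) : Prop :=
  exists (C : R) (N : nat), forall n, (N <= n)%N ->
    Rabs (f n) <= C * Rabs (g n).

Definition PL (i : nat) (L : seq bool -> Prop) : Prop :=
  exists (M : ratm) (T : nat -> nat),
    bigO (fun n => INR (T n)) (fun n => ln (INR n) ^ i)
    /\ decides_in_time M L T.

(* Main.v *)
Require Import Defs.
From Stdlib Require Import Reals.
From mathcomp Require Import all_boot.
From Stdlib Require Import Lra.
From mathcomp Require Import zify.

(** The separating language consists of the words having a one at every address
    (inside the word) whose binary notation has at most [i.+1] ones. There are
    about [log^(i+1) n] such addresses, all of them sensitive on the word
    [1 ... 1], and a machine scans one input cell per step, so time
    [O(log^i n)] is not enough. Conversely the index words of these addresses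
    form a tree, which a machine explores depth first in a constant number of
    steps per node: a child is reached by appending a bit to the index tape,
    and a blank input cell shows that the address exceeds the input length. *)

Set Implicit Arguments.
Unset Strict Implicit.
Unset Printing Implicit Defensive.

(** * Binary words and the addresses they denote *)

Definition addr (w : seq bool) : nat := address (map Some w).

Lemma address_rec_cat a (v w : seq bool) :
  address_rec a (map Some (v ++ w)) =
  address_rec (address_rec a (map Some v)) (map Some w).
Proof. by elim: v a => //= b v IH a. Qed.

Lemma addr_rcons w b : addr (rcons w b) = (addr w).*2 + b.
Proof. by rewrite /addr /address -cats1 address_rec_cat. Qed.

(** Lists holding the same index tape may differ in trailing blanks, so tapes are compared cell by
    cell. *)
Lemma address_ext s (w : seq bool) :
  nth None s =1 nth None (map Some w) -> address s = addr w.
Proof.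
rewrite /addr /address; elim: w 0 s => [|b w IH] a [|o s] E //=.
- by move: (E 0) => /= ->.
- by have := E 0.
by have /= -> := E 0; apply: IH => k; have := E k.+1.
Qed.

Lemma addr_true_gt0 v : 0 < addr (true :: v).
Proof.
elim/last_ind: v => // v b IH.
by rewrite -rcons_cons addr_rcons; lia.
Qed.

Lemma addr_true_lt v : addr (true :: v) < 2 ^ (size v).+1.
Proof.
elim/last_ind: v => // v b IH.
rewrite -rcons_cons addr_rcons size_rcons expnS; move: IH; case: b; lia.
Qed.

(** The leading one rules out padding by zeros; the last bit is the parity of the address, and
    halving removes it. *)
Lemma addr_true_inj : injective (fun v => addr (true :: v)).
Proof.
elim/last_ind=> [|v b IH] w; case/lastP: w => [|w b'] //;
  rewrite -?rcons_cons ?addr_rcons.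
- by have := addr_true_gt0 w; rewrite -[addr [:: true]]/1 => w0 E; lia.
- by have := addr_true_gt0 v; rewrite -[addr [:: true]]/1 => v0 E; lia.
move=> E; have Eb : b = b' by case: b b' E => [] []; lia.
by rewrite Eb in E *; congr rcons; apply: IH; lia.
Qed.

(** * Words of bounded length with few ones, listed in preorder of the search tree, and their
    number *)

Fixpoint sparse_words (d c : nat) : seq (seq bool) :=
  if d is d'.+1 then
    [::] :: map (cons false) (sparse_words d' c)
         ++ (if c is c'.+1 then map (cons true) (sparse_words d' c') else [::])
  else [:: [::]].

Lemma sparse_words_uniq d c : uniq (sparse_words d c).
Proof.
elim: d c => //= d IH c.
have consI (b : bool) : injective (cons b) by move=> u v [].
rewrite cat_uniq mem_cat negb_or (map_inj_uniq (consI false)) IH andTb.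
apply/and3P; split.
- apply/andP; split; first by apply/mapP => -[].
  by case: c => //= c; apply/mapP => -[].
- case: c => //= c; apply/hasPn => _ /mapP[v _ ->].
  by apply/mapP => -[].
- by case: c => //= c; rewrite (map_inj_uniq (consI true)).
Qed.

Lemma sparse_wordsP d c v :
  v \in sparse_words d c -> size v <= d /\ count id v <= c.
Proof.
elim: d c v => [|d IH] c v /=; first by rewrite inE => /eqP->.
rewrite inE mem_cat => /or3P[/eqP-> //|/mapP[u /IH[Hs Hc] ->]|].
  by split; rewrite //= add0n.
by case: c => // c /mapP[u /IH[Hs Hc] ->]; split; rewrite //= add1n ltnS.
Qed.

Lemma size_sparse_wordsS d c :
  size (sparse_words d.+1 c) =
  (size (sparse_words d c) +
   (if c is c'.+1 then size (sparse_words d c') else 0)).+1.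
Proof. by rewrite /= size_cat size_map; case: c => //= c; rewrite size_map. Qed.

Lemma size_sparse_words_le d c : size (sparse_words d c) <= d.+1 ^ c.+1.
Proof.
elim: d c => [|d IH] c; first by rewrite exp1n.
rewrite size_sparse_wordsS; case: c => [|c].
  by have := IH 0; rewrite !expn1; lia.
have := IH c; have := IH c.+1; rewrite ![_ ^ c.+2]expnS.
(* Strictness pays for the root, the extra [.+1] of the recurrence. *)
have : d.+1 ^ c.+1 < d.+2 ^ c.+1 by rewrite ltn_exp2r.
nia.
Qed.

(** A word of length below [d] with exactly [c] ones is a choice of [c.+1] numbers below [d]: the
    positions of its ones and its length. The induction is Pascal's rule. *)
Lemma size_sparse_words_ge d c : 'C(d, c.+1) <= size (sparse_words d c).
Proof.
elim: d c => // d IH c; rewrite size_sparse_wordsS binS.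
case: c => [|c]; first by have := IH 0; rewrite bin0; lia.
by have := IH c; have := IH c.+1; lia.
Qed.

(** * The separating language, and its restriction to a subtree of addresses *)

Definition sparse_lang (i : nat) (x : seq bool) : Prop :=
  forall v, count id v <= i -> addr (true :: v) < size x ->
  nth true x (addr (true :: v)).

(** What the search has to verify below node [w] with [c] further ones allowed; for the root
    [[:: true]] and [c = i] it is [sparse_lang i x]. *)
Definition sparse_below (x : seq bool) (w : seq bool) (c : nat) : Prop :=
  forall v, count id v <= c -> addr (w ++ v) < size x ->
  nth true x (addr (w ++ v)).

Lemma addr_cat_ge w v : addr w <= addr (w ++ v).
Proof.
elim/last_ind: v => [|v b IH]; first by rewrite cats0.
by rewrite -rcons_cat addr_rcons; lia.
Qed.

(** Appending bits never decreases an address, so the search may turn back at the first blank input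
    cell. *)
Lemma sparse_below_out x w c : size x <= addr w -> sparse_below x w c.
Proof. by move=> le_xw v _; have := addr_cat_ge w v; lia. Qed.

Lemma sparse_below_node x w c : sparse_below x w c <->
  [/\ addr w < size x -> nth true x (addr w),
      sparse_below x (rcons w false) c
    & 0 < c -> sparse_below x (rcons w true) c.-1].
Proof.
split=> [Hw | [Hw H0 H1] [|[] v] /=].
- split=> [|v cv|c0 v cv]; rewrite ?cat_rcons; last by apply: Hw => /=; lia.
    by have := Hw [::]; rewrite cats0; apply.
  exact: Hw.
- by rewrite cats0.
- by rewrite -cat_rcons => cv; apply: H1; lia.
- by rewrite -cat_rcons add0n; apply: H0.
Qed.

(** * The searching machine *)

Section Machine.

Variable i : nat.

(* The heads of the input and of the memory tape sit on the cell addressed by *)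
(* the current node. A jump forgets the control state, so the search mode     *)
(* travels in cell 0 of the output tape, whose index tape stays blank:        *)
(* [down l c] on arrival from the parent through edge [l] ([None] at the      *)
(* root) with [c] further ones allowed, [up b] on return from child [b]. The  *)
(* memory cell of a node keeps [l] and [c] for that return.                   *)
Definition symbol : finType := option (bool * option bool * 'I_i.+1).
Definition down (l : option bool) (c : 'I_i.+1) : symbol := Some (true, l, c).
Definition up (b : bool) : symbol := Some (false, Some b, ord0).
Definition input_symbol (b : bool) : symbol := Some (b, None, ord0).

Definition control : finType := (bool * bool)%type.
Definition q_move : control := (false, true).
Definition q_jump : control := (false, false).
Definition q_acc : control := (true, true).
Definition q_rej : control := (true, false).

Definition reg_tape : 'I_3 := lift ord0 ord0.
Definition mem_tape : 'I_3 := lift ord0 (lift ord0 ord0).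

Definition act (q : control) (r m : symbol) (o : option bool) (d : direction) :
    action control symbol 1 :=
  Action q [ffun j => if j == ord0 then r else m]
    [ffun t => if t == reg_tape then None else o] [ffun=> MoveS] [ffun=> d].

(** The index head stands just past the word, so a return takes two steps: move left here, then
    erase the last bit and jump from [q_move]. *)
Definition leave (l : option bool) (r m : symbol) : action control symbol 1 :=
  if l is Some b then act q_move (up b) m None MoveL
  else act q_acc r m None MoveS.

(** State [q_move] has two uses, told apart by the register: a blank one means the start, where the
    root address 1 is written; otherwise a return is being completed. *)
Definition search_table (q : control) (a r m : symbol) :
    action control symbol 1 :=
  if q == q_move then
    if r is Some _ then act q_jump r m None MoveS
    else act q_jump (down None ord_max) m (Some true) MoveR
  else match r with
  | Some (true, l, c) =>
      match a with
      | None => leave l r m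
      | Some (false, _, _) => act q_rej r m None MoveS
      | Some (true, _, _) => act q_jump (down (Some false) c) (down l c)
                               (Some false) MoveR
      end
  | Some (false, Some b, _) =>
      if m is Some (_, l, c) then
        if ~~ b && (0 < c) then
          act q_jump (down (Some true) (inord c.-1)) m (Some true) MoveR
        else leave l r m
      else act q_rej r m None MoveS
  | _ => act q_rej r m None MoveS
  end.

Lemma input_symbol_inj : injective input_symbol.
Proof. by move=> b b' []. Qed.

Lemma input_symbol_blank b : input_symbol b != None.
Proof. by []. Qed.

Lemma special_states_uniq : uniq [:: q_jump; q_acc; q_rej].
Proof. by []. Qed.

Definition searcher : ratm :=
  @RATM control symbol 1 None input_symbol input_symbol_inj input_symbol_blank
    q_move q_jump q_acc q_rej special_states_uniq
    (fun q s => search_table q (s ord0) (s reg_tape) (s mem_tape)).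

(** * Correctness and running time of the search *)

Variable x : seq bool.

Definition update (T : Type) (f : nat -> T) (k : nat) (y : T) : nat -> T :=
  fun j => if j == k then y else f j.

Record represents (C : config searcher) (q : control) (a : nat)
    (idx : nat -> option bool) (h : nat) (mem : nat -> symbol) (r : symbol) :
    Prop := Represents {
  rep_state : cstate C = q;
  rep_input : tape C ord0 = map input_symbol x;
  rep_reg : nth None (tape C reg_tape) 0 = r;
  rep_mem : nth None (tape C mem_tape) =1 mem;
  rep_head_reg : tape_head C reg_tape = 0;
  rep_head : forall t, t != reg_tape -> tape_head C t = a;
  rep_idx_reg : nth None (index_tape C reg_tape) =1 fun=> None;
  rep_idx : forall t, t != reg_tape -> nth None (index_tape C t) =1 idx;
  rep_idx_head : forall t, t != reg_tape -> Defs.index_head C t = h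
}.

Definition at_node (C : config searcher) (w : seq bool) :=
  represents C q_jump (addr w) (nth None (map Some w)) (size w).

Lemma represents_step C q a idx h mem r q' r' m' o dir :
  represents C q a idx h mem r -> q.1 = false ->
  search_table q (nth None (map input_symbol x) a) r (mem a)
    = act q' r' m' o dir ->
  forall a' idx', update idx h o =1 idx' ->
  (if q' == q_jump then exists2 w, a' = addr w & idx' = nth None (map Some w)
   else a' = a) ->
  represents (step C) q' a' idx' (move_head dir h) (update mem a m') r'.
Proof.
move=> [Es Ei Er Em Hr Ha Ir Ix Ih] q_run E a' idx' Eidx Ea'.
have Eh : halted C = false.
  by rewrite /halted Es; case: q q_run {Es E} => [[] []].
have Ed : delta (cstate C) (scanned C) = act q' r' m' o dir.
  by rewrite /= Es !ffunE Hr !Ha //= Ei Er Em.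
have Ixs t : t != reg_tape ->
    nth None (set_nth None (index_tape C t) (Defs.index_head C t) o)
      =1 idx'.
  by move=> t_r k; rewrite nth_set_nth /= Ih // Ix // -Eidx.
have Irs : nth None (set_nth None (index_tape C reg_tape)
    (Defs.index_head C reg_tape) None) =1 fun=> None.
  by move=> k; rewrite nth_set_nth /= Ir; case: eqP.
rewrite /step Eh Ed; split=> //=.
- by rewrite ffunE unlift_none.
- by rewrite ffunE liftK ffunE nth_set_nth /= Hr.
- move=> k; rewrite ffunE liftK ffunE /= nth_set_nth /= Em Ha //.
- rewrite !ffunE; case: ifP => _ //.
  (* The blank index tape of the register denotes address 0, so a jump keeps its head on cell 0. *)
  by apply: (address_ext (w := [::])) => k; rewrite Irs nth_nil.
- move=> t t_r; rewrite !ffunE (negPf t_r); case: ifP Ea' => [_ [w -> Ew]|_ ->].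
    by apply: address_ext => k; rewrite Ixs // Ew.
  by rewrite Ha.
- by move=> k; rewrite !ffunE eqxx Irs.
- by move=> t t_r k; rewrite !ffunE (negPf t_r) Ixs.
- by move=> t t_r; rewrite !ffunE Ih.
Qed.

Lemma update_push (w : seq bool) b :
  update (nth None (map Some w)) (size w) (Some b)
    =1 nth None (map Some (rcons w b)).
Proof.
move=> k; rewrite /update map_rcons nth_rcons size_map.
case: ltngtP => // lt_wk; by rewrite nth_default ?size_map // ltnW.
Qed.

Lemma update_end (w : seq bool) :
  update (nth None (map Some w)) (size w) None =1 nth None (map Some w).
Proof.
by move=> k; rewrite /update; case: eqP => // ->; rewrite nth_default ?size_map.
Qed.

Lemma update_pop (w : seq bool) b :
  update (nth None (map Some (rcons w b))) (size w) None
    =1 nth None (map Some w).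
Proof.
move=> k; rewrite /update map_rcons nth_rcons size_map.
by case: ltngtP => // [lt_wk|->]; rewrite nth_default ?size_map // ltnW.
Qed.

Lemma at_node_descend C w mem r r' m' b : at_node C w mem r ->
  search_table q_jump (nth None (map input_symbol x) (addr w)) r (mem (addr w))
    = act q_jump r' m' (Some b) MoveR ->
  at_node (step C) (rcons w b) (update mem (addr w) m') r'.
Proof.
move=> Cw E; rewrite /at_node size_rcons.
apply: (represents_step Cw _ E) => //; first exact: update_push.
by exists (rcons w b).
Qed.

Definition node (p : seq bool) (l : option bool) : seq bool :=
  if l is Some b then rcons p b else [:: true].

(** Memory is preserved only below the address of the subtree root. This protects the records of all
    ancestors, since appending a bit to a nonzero address, save for a zero address, increases it. *)
Definition explored (C : config searcher) (p : seq bool) (l : option bool)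
    (mem : nat -> symbol) : Prop :=
  if l is Some b then
    exists2 mem', at_node C p mem' (up b)
                & forall k, k < addr (node p l) -> mem' k = mem k
  else cstate C = q_acc.

Lemma explored_frame C p l mem mem' :
  (forall k, k < addr (node p l) -> mem k = mem' k) ->
  explored C p l mem -> explored C p l mem'.
Proof.
case: l => //= b E [m Cp Em]; exists m => // k lt_k.
by rewrite Em ?E.
Qed.

Lemma leave_explored C p l mem r : at_node C (node p l) mem r ->
  search_table q_jump (nth None (map input_symbol x) (addr (node p l))) r
    (mem (addr (node p l))) = leave l r (mem (addr (node p l))) ->
  exists2 t, t <= 2 & explored (iter t (@step searcher) C) p l mem.
Proof.
case: l => [b|] /= Cw E; last first.
  exists 1 => //=.
  exact: rep_state (represents_step Cw _ E (update_end _) erefl).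
have Cm := represents_step Cw erefl E (update_end _) erefl.
rewrite /= size_rcons in Cm.
exists 2 => //; eexists.
  apply: (represents_step Cm erefl erefl (update_pop _ _)).
  by exists p.
by move=> k lt_k; rewrite /update (ltn_eqF lt_k).
Qed.

(** Each appended bit at least doubles the address, so [d] bounds the depth of the part inside the
    input. A node costs at most four steps of its own: one descent to each child and two steps to
    leave. *)
Lemma explore_subtree d p l c mem C :
  at_node C (node p l) mem (down l c) ->
  0 < addr (node p l) -> size x <= addr (node p l) * 2 ^ d ->
  exists2 t, t <= 4 * size (sparse_words d c) &
    (sparse_below x (node p l) c /\ explored (iter t (@step searcher) C) p l mem)
    \/ (~ sparse_below x (node p l) c
       /\ cstate (iter t (@step searcher) C) = q_rej).
Proof.
elim: d p l c mem C => [|d IH] p l c mem C Cw w_gt0 le_x;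
  set w := node p l in Cw w_gt0 le_x *;
  (have [le_xw|lt_wx] := leqP (size x) (addr w);
   [have [|t le_t Ht] := @leave_explored C p l _ _ Cw;
     [by rewrite [nth _ _ _]nth_default ?size_map
     |exists t; [|by left; split=> //; exact: sparse_below_out]]|]).
- exact: leq_trans le_t _.
(* At [d = 0] the node already lies outside the input. *)
- by move: lt_wx le_x; rewrite muln1 ltnNge => /negPf->.
- by rewrite size_sparse_wordsS; lia.
have Ein : nth None (map input_symbol x) (addr w)
    = input_symbol (nth true x (addr w)) by rewrite (nth_map true).
case Ex : (nth true x (addr w)) Ein => Ein; last first.
  exists 1; first by rewrite size_sparse_wordsS; lia.
  right; split=> [/sparse_below_node[]|]; first by rewrite Ex => /(_ lt_wx).
  have Et : search_table q_jump (nth None (map input_symbol x) (addr w))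
      (down l c) (mem (addr w)) = act q_rej (down l c) (mem (addr w)) None MoveS
    by rewrite Ein.
  exact: rep_state (represents_step Cw _ Et (update_end _) erefl).
have Et : search_table q_jump (nth None (map input_symbol x) (addr w))
      (down l c) (mem (addr w))
    = act q_jump (down (Some false) c) (down l c) (Some false) MoveR
  by rewrite Ein.
have C0 := at_node_descend Cw Et.
have [||t0 le_t0 H0] := IH w (Some false) c _ _ C0.
- by rewrite addr_rcons; lia.
- by rewrite addr_rcons; move: le_x; rewrite expnS; nia.
have size_wS := size_sparse_wordsS d c.
case: H0 => [[ok0 [mem0 C0' Emem0]] | [bad0 rej0]]; last first.
  exists t0.+1; first by rewrite size_wS; lia.
  by right; rewrite iterSr; split=> // /sparse_below_node[].
rewrite -iterSr in C0'.
(* The record of [w] survives the visit of the child, whose address [(addr w).*2] is larger because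
   [addr w] is positive. *)
have mem0w : mem0 (addr w) = down l c.
  by rewrite Emem0 /update ?eqxx //= addr_rcons; lia.
have mem0_lt k : k < addr w -> mem0 k = mem k.
  move=> lt_k; rewrite Emem0 /update ?(ltn_eqF lt_k) //= addr_rcons; lia.
have [c0|c_gt0] := posnP c.
  have [|t1 le_t1 H1] := @leave_explored _ p l _ _ C0'.
    by rewrite mem0w /search_table /= c0.
  exists (t1 + t0.+1); first by rewrite size_wS; lia.
  left; split; first by apply/sparse_below_node; split=> //; rewrite c0.
  by rewrite iterD; apply: explored_frame H1.
have Et0 : search_table q_jump (nth None (map input_symbol x) (addr w))
      (up false) (mem0 (addr w))
    = act q_jump (down (Some true) (inord c.-1)) (down l c) (Some true) MoveR
  by rewrite mem0w /search_table /= c_gt0.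
have C1 := at_node_descend C0' Et0.
have [||t1 le_t1 H1] := IH w (Some true) _ _ _ C1.
- by rewrite addr_rcons; lia.
- by rewrite addr_rcons; move: le_x; rewrite expnS; nia.
have Ec : (inord c.-1 : 'I_i.+1) = c.-1 :> nat.
  by rewrite inordK // (leq_ltn_trans (leq_pred _)).
rewrite Ec in le_t1 H1.
have size_wS' : size (sparse_words d.+1 c)
    = (size (sparse_words d c) + size (sparse_words d c.-1)).+1.
  by rewrite size_wS; case: (nat_of_ord c) c_gt0.
case: H1 => [[ok1 [mem1 C1' Emem1]] | [bad1 rej1]]; last first.
  exists (t1 + (t0.+2)); first by rewrite size_wS'; lia.
  by right; rewrite iterD; split=> // /sparse_below_node[_ _ /(_ c_gt0)].
have mem1w : mem1 (addr w) = down l c.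
  by rewrite Emem1 /update ?eqxx //= addr_rcons; lia.
have mem1_lt k : k < addr w -> mem1 k = mem k.
  move=> lt_k; rewrite Emem1 /update ?(ltn_eqF lt_k) ?mem0_lt //= addr_rcons; lia.
have [|t2 le_t2 H2] := @leave_explored _ p l _ _ C1'; first by rewrite mem1w.
exists (t2 + (t1 + t0.+2)); first by rewrite size_wS'; lia.
left; split; first by apply/sparse_below_node; split.
by rewrite iterD iterD; apply: explored_frame H2.
Qed.

Lemma represents_init :
  represents (init_config searcher x) q_move 0 (fun=> None) 0 (fun=> None) None.
Proof.
by split=> [|||k||t _|k|t _ k|t _] /=; rewrite ?ffunE //= ?nth_nil.
Qed.

Lemma searcher_halts_on_input :
  exists n, [/\ n <= (4 * (trunc_log 2 (size x)).+2 ^ i.+1).+1,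
    halted (run searcher x n)
    & cstate (run searcher x n) = qaccept searcher <-> sparse_lang i x].
Proof.
have C1 : at_node (step (init_config searcher x)) [:: true]
    (update (fun=> None) 0 None) (down None ord_max).
  apply: (represents_step represents_init erefl erefl); last by exists [:: true].
  by case=> [|k] //=; rewrite nth_nil.
(* The root has address 1 and [size x] is below [2 ^ (trunc_log 2 (size x)).+1], which gives the
   depth. *)
have [||t le_t Ht] :=
  explore_subtree (d := (trunc_log 2 (size x)).+1) (p := [::]) (l := None) C1.
- by [].
- by rewrite mul1n ltnW // trunc_log_ltn.
exists t.+1; rewrite /run iterSr; split.
- by rewrite ltnS (leq_trans le_t) // leq_mul // size_sparse_words_le.
- by case: Ht => -[_] /= E; rewrite /halted E.
- by case: Ht => -[H] /= E; rewrite E; split.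
Qed.

End Machine.

Lemma searcher_decides i :
  decides_in_time (searcher i) (sparse_lang i)
    (fun n => (4 * (trunc_log 2 n).+2 ^ i.+1).+1).
Proof. by move=> x; apply: searcher_halts_on_input. Qed.

(** * Lower bound by sensitivity of the input *)

Section Adversary.

Variable M : ratm.

Definition agree_off (a : nat) (C D : config M) : Prop :=
  [/\ cstate C = cstate D, tape_head C = tape_head D,
      index_tape C = index_tape D, Defs.index_head C = Defs.index_head D
    & forall t k, (t != ord0) || (k != a) ->
      nth (blank M) (tape C t) k = nth (blank M) (tape D t) k].

(** The input tape is never written, so an unscanned difference in cell [a] neither influences the
    step nor spreads. *)
Lemma agree_off_step a C D :
  tape_head C ord0 != a -> agree_off a C D -> agree_off a (step C) (step D).
Proof.
move=> head_a [Es Eh Ei Eih Et].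
have Esc : scanned C = scanned D.
  apply/ffunP=> t; rewrite !ffunE -Eh Et //.
  by have [->|] := eqVneq t ord0.
have Ehalt : halted D = halted C by rewrite /halted Es.
rewrite /step Ehalt; case: ifP => // _; rewrite -Es -Esc -Eh -Ei -Eih.
split=> //= t k; rewrite !ffunE; case: unliftP => [j ->|->] ta; last exact: Et.
by rewrite !nth_set_nth /= Et.
Qed.

Lemma agree_off_run a x y n :
  (forall k, k != a ->
     nth (blank M) (map (@insym M) x) k = nth (blank M) (map (@insym M) y) k) ->
  (forall s, s < n -> tape_head (run M x s) ord0 != a) ->
  agree_off a (run M x n) (run M y n).
Proof.
move=> Exy; elim: n => [|n IH] unread.
  split=> //= t k; rewrite !ffunE; case: eqP => //= _; exact: Exy.
apply: agree_off_step; first exact: unread.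
by apply: IH => s lt_sn; apply: unread; apply: ltnW.
Qed.

Lemma halted_run_stable x m n :
  halted (run M x m) -> m <= n -> run M x n = run M x m.
Proof.
move=> Hm /subnK <-; rewrite /run iterD -/(run M x m).
by elim: (n - m) => //= k ->; rewrite /step Hm.
Qed.

Definition flip (x : seq bool) (a : nat) : seq bool :=
  set_nth false x a (~~ nth false x a).

(* A sensitive position must be scanned, and each step scans one input cell. *)
Lemma sensitivity_le_time L T x (A : seq nat) :
  decides_in_time M L T -> L x -> uniq A ->
  (forall a, a \in A -> a < size x /\ ~ L (flip x a)) -> size A <= T (size x).
Proof.
move=> decT Lx uA sensA; have [n [le_n Hn [_ /(_ Lx) accn]]] := decT x.
apply: leq_trans le_n.
rewrite -(size_iota 0 n).
rewrite -(size_map (fun s => tape_head (run M x s) ord0) (iota 0 n)).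
apply: uniq_leq_size => // a /sensA[lt_a nL].
apply/negPn/negP => unread; apply: nL.
have size_flip : size (flip x a) = size x.
  by rewrite size_set_nth; apply/maxn_idPr.
have [Es _ _ _ _] : agree_off a (run M x n) (run M (flip x a) n).
  apply: agree_off_run => [k ka|s lt_s].
    have [lt_k|le_k] := ltnP k (size x); last first.
      by rewrite !nth_default // size_map ?size_flip.
    by rewrite !(nth_map false) ?size_flip // nth_set_nth /= (negPf ka).
  apply: contraNneq unread => <-; apply: map_f; by rewrite mem_iota.
have [n' [_ Hn' [accL _]]] := decT (flip x a); apply: accL.
have Hn2 : halted (run M (flip x a) n) by rewrite /halted -Es.
(* The halting time supplied for the flipped word may differ from [n], but halted configurations no
   longer change. *)
have E : run M (flip x a) n' = run M (flip x a) n.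
  have [le|/ltnW le] := leqP n n'; first exact: halted_run_stable.
  by symmetry; apply: halted_run_stable.
by rewrite E -Es.
Qed.

End Adversary.

(** On the all-ones word of length [2 ^ d.+1], every address [true :: v] with [v] in the list fits,
    and flipping its bit leaves the language. *)
Lemma sparse_words_le_time i M T d :
  decides_in_time M (sparse_lang i) T ->
  size (sparse_words d i) <= T (2 ^ d.+1).
Proof.
move=> decT; set n := 2 ^ d.+1.
rewrite -(size_map (fun v => addr (true :: v))) -(size_nseq n true).
apply: (sensitivity_le_time decT).
- by move=> v _; rewrite size_nseq => lt_n; rewrite nth_nseq lt_n.
- by rewrite map_inj_uniq ?sparse_words_uniq //; exact: addr_true_inj.
move=> _ /mapP[v /sparse_wordsP[size_v count_v] ->].
have lt_n : addr (true :: v) < n.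
  by apply: leq_trans (addr_true_lt v) _; rewrite leq_exp2l.
rewrite size_nseq; split=> // /(_ v count_v).
rewrite size_set_nth size_nseq leq_max lt_n orbT => /(_ isT).
rewrite (set_nth_default false) ?size_set_nth ?size_nseq ?leq_max ?lt_n ?orbT //.
by rewrite nth_set_nth /= eqxx nth_nseq lt_n.
Qed.

(** The falling factorial has [k.+1] factors, the least of which is [m]. *)
Lemma expn_le_ffact m k : m ^ k.+1 <= (m + k) ^_ k.+1.
Proof.
elim: k => [|k IH]; first by rewrite addn0 ffactn1.
by rewrite addnS ffactSS expnS leq_mul // -addnS leq_addr.
Qed.

Lemma expn_le_sparse_words m i :
  m ^ i.+1 <= size (sparse_words (m + i) i) * i.+1`!.
Proof.
apply: leq_trans (expn_le_ffact m i) _.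
by rewrite -bin_ffact leq_mul // size_sparse_words_ge.
Qed.

(** * Logarithm estimates and the separation *)

Local Open Scope R_scope.

Lemma INR_expn (m k : nat) : INR (m ^ k)%N = INR m ^ k.
Proof. by elim: k => //= k IH; rewrite expnS mult_INR IH. Qed.

Lemma INR_leq (m n : nat) : (m <= n)%N -> INR m <= INR n.
Proof. by move/leP; apply: le_INR. Qed.

Lemma ln_le (a b : R) : 0 < a -> a <= b -> ln a <= ln b.
Proof.
move=> a0 [lt_ab|->]; last exact: Rle_refl.
by left; apply: ln_increasing.
Qed.

Lemma ln_ge1 (n : nat) : (3 <= n)%N -> 1 <= ln (INR n).
Proof.
move=> /INR_leq n3; rewrite -(ln_exp 1); have e3 := exp_le_3.
have e0 := exp_pos 1; rewrite /= in n3.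
by apply: ln_le => //; lra.
Qed.

Lemma bigO_intro (f : nat -> R) (g : nat -> R) (K : R) (N : nat) :
  (forall n, (N <= n)%N -> 0 <= f n <= K * g n /\ 0 <= g n) -> bigO f g.
Proof.
move=> H; exists K, N => n /H[[f0 fg] g0].
by rewrite !Rabs_pos_eq.
Qed.

Lemma bigO_ln_pow_succ (f : nat -> R) (i : nat) :
  bigO f (fun n => ln (INR n) ^ i) -> bigO f (fun n => ln (INR n) ^ i.+1).
Proof.
(* From 3 on the logarithm is at least 1; [Rabs K] covers a negative constant. *)
move=> [K [N HK]]; exists (Rabs K), (maxn N 3) => n.
rewrite geq_max => /andP[/HK Hn /ln_ge1 ln1].
apply: (Rle_trans _ _ _ Hn) => /=.
have p0 : 0 <= ln (INR n) ^ i by apply: pow_le; lra.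
rewrite Rabs_mult (Rabs_pos_eq _ p0) (Rabs_pos_eq (ln _)); last lra.
have KK := Rle_abs K; have K0 := Rabs_pos K.
apply: (Rle_trans _ (Rabs K * ln (INR n) ^ i)); first exact: Rmult_le_compat_r.
by apply: Rmult_le_compat_l => //; nra.
Qed.

Lemma ln2_ge_half : / 2 <= ln 2.
Proof. have := ln_lt_2; lra. Qed.

Lemma trunc_log_le_ln (n : nat) : (0 < n)%N ->
  INR (trunc_log 2 n) <= 2 * ln (INR n).
Proof.
move=> n0; have := trunc_logP (isT : 1 < 2)%N n0.
move=> /INR_leq; rewrite INR_expn => le_n.
have p0 : 0 < INR 2 ^ trunc_log 2 n by apply: pow_lt; rewrite /=; lra.
have := ln_le p0 le_n; rewrite ln_pow; last by rewrite /=; lra.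
have := ln2_ge_half; have := pos_INR (trunc_log 2 n).
rewrite [INR 2]/=; rewrite -[1 + 1]/2; nra.
Qed.

Lemma search_time_bigO (i : nat) :
  bigO (fun n => INR (4 * (trunc_log 2 n).+2 ^ i.+1).+1)
       (fun n => ln (INR n) ^ i.+1).
Proof.
(* The inner 4 comes from [trunc_log 2 n + 2 <= 4 * ln n]; the summand 1 absorbs the final
   successor. *)
apply: (@bigO_intro _ _ (4 * 4 ^ i.+1 + 1) 3) => n n3.
have ln1 := ln_ge1 n3; have lnp : 1 <= ln (INR n) ^ i.+1 by apply: pow_R1_Rle.
split; last lra; split; first exact: pos_INR.
rewrite S_INR mult_INR INR_expn [INR 4](_ : _ = 4); last by rewrite /=; lra.
have le_l : INR (trunc_log 2 n).+2 <= 4 * ln (INR n).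
  by rewrite !S_INR; have := @trunc_log_le_ln n (ltnW (ltnW n3)); lra.
have := pow_incr _ _ i.+1 (conj (pos_INR _) le_l).
by rewrite Rpow_mult_distr; lra.
Qed.

Lemma sparse_lang_in_PL (i : nat) : PL i.+1 (sparse_lang i).
Proof.
exists (searcher i), (fun n => (4 * (trunc_log 2 n).+2 ^ i.+1).+1)%N.
by split; [apply: search_time_bigO | apply: searcher_decides].
Qed.

Lemma sparse_lang_notin_PL (i : nat) : ~ PL i (sparse_lang i).
Proof.
move=> [M [T [[K [N HK]] decT]]].
set F := INR i.+1`!.
(* Counting gives [m ^ i.+1 <= T n * F], while the assumed bound gives
   [T n <= Rabs K * (2 * m) ^ i]; any [m] above this threshold contradicts both. The summand [i.+1]
   of [m] ensures [d.+1 <= 2 * m] and [m > 0]. *)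
have [m0 Hm0] := INR_unbounded (Rabs K * 2 ^ i * F).
pose m := (N + i.+1 + m0)%N; pose d := (m + i)%N; pose n := (2 ^ d.+1)%N.
have le_N : (N <= n)%N.
  by apply: leq_trans (ltnW (ltn_expl d.+1 (isT : 1 < 2)%N)); rewrite /d /m; lia.
have := HK n le_N; rewrite Rabs_pos_eq; last exact: pos_INR.
have lnn : 0 <= ln (INR n) <= INR (2 * m)%N.
  rewrite INR_expn ln_pow; last by rewrite /=; lra.
  have ln2_le1 : ln 2 <= 1.
    rewrite -[X in _ <= X](ln_exp 1); apply: ln_le; first lra.
    by have := exp_ineq1_le 1; lra.
  have ln2_0 := ln2_ge_half; have d0 := pos_INR d.+1.
  have dm : INR d.+1 <= INR (2 * m)%N by apply: INR_leq; rewrite /d /m; lia.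
  by rewrite [INR 2]/= -[1 + 1]/2; nra.
have p0 : 0 <= ln (INR n) ^ i by apply: pow_le; lra.
rewrite (Rabs_pos_eq _ p0) => TK.
have mp : 0 < INR m ^ i.
  by apply: pow_lt; apply: lt_0_INR; apply/ltP; rewrite /m; lia.
have TF : INR m * INR m ^ i <= INR (T n) * F.
  rewrite -INR_expn -!mult_INR !multE -expnS; apply: INR_leq.
  apply: leq_trans (expn_le_sparse_words m i) _.
  by rewrite leq_mul // (sparse_words_le_time _ decT).
have pm : ln (INR n) ^ i <= 2 ^ i * INR m ^ i.
  rewrite -Rpow_mult_distr; apply: pow_incr.
  by move: lnn; rewrite mult_INR [INR 2]/=; lra.
have F0 : 0 <= F by exact: pos_INR.
have TK2 : INR (T n) <= Rabs K * (2 ^ i * INR m ^ i).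
  apply: (Rle_trans _ _ _ TK); have := Rle_abs K; have := Rabs_pos K; nra.
have : INR m * INR m ^ i <= Rabs K * 2 ^ i * F * INR m ^ i.
  apply: (Rle_trans _ _ _ TF).
  by have := Rmult_le_compat_r _ _ _ F0 TK2; lra.
move/Rmult_le_reg_r => /(_ mp).
have : INR m0 <= INR m by apply: INR_leq; rewrite /m; lia.
lra.
Qed.

Local Close Scope R_scope.

Theorem theorem2 (i : nat) (hi : 1 <= i) :
  (forall L : seq bool -> Prop, PL i L -> PL i.+1 L) /\
  (exists L : seq bool -> Prop, PL i.+1 L /\ ~ PL i L).
Proof.
split=> [L [M [T [OT decT]]]|].
  by exists M, T; split=> //; apply: bigO_ln_pow_succ.
by exists (sparse_lang i); split;
  [apply: sparse_lang_in_PL | apply: sparse_lang_notin_PL].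
Qed.
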